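(* Let $E$ be a truncated Riesz space with truncation $x\mapsto x^{*}$, and let $\|\cdot\|$ be a lattice norm on $E$. Then $\|\cdot\|$ can be extended to a lattice norm on the unitization $E\oplus\mathbb{R}$ if and only if the truncation is norm-bounded, i.e., there exists $M\in(0,\infty)$ such that $\|x^{*}\|\leq M$ for all $x\in E^{+}$.
   Context: All Riesz spaces are real. A truncated Riesz space is a nonzero Riesz space $E$ together with a truncation, i.e. a nonzero map $x\mapsto x^{*}$ from the positive cone $E^{+}$ into itself such that $x\wedge y^{*}\leq x^{*}\leq x$ for all $x,y\in E^{+}$. Unitization: the vector space direct sum $E\oplus\mathbb{R}$ (elements written $x+\alpha$ with $x\in E$, $\alpha\in\mathbb{R}$; $1$ denotes $0+1$; $x\in E$ is identified with $x+0$) is a Riesz space whose absolute value is given by $|x+0|=|x|$ and, for $\alpha\neq 0$, $|x+\alpha|=|x|-2|\alpha|\left(\tfrac{1}{\alpha}x^{-}\vee\tfrac{-1}{\alpha}x^{+}\right)^{*}+|\alpha|$. Equivalently, $x+\alpha\geq 0$ if and only if either $\alpha=0$ and $x\geq 0$, or $\alpha>0$ and $\left(\tfrac1\alpha x^{-}\right)^{*}=\tfrac1\alpha x^{-}$. For this structure (known from earlier work) $E$ is a Riesz subspace of $E\oplus\mathbb{R}$ and $x^{*}=1\wedge x$ for all $x\in E^{+}$. A lattice norm on a Riesz space is a norm such that $|u|\leq|v|$ implies $\|u\|\leq\|v\|$. The normalization $\sup\{\|x^*\|:x\in E^+\}=1$ is not assumed here. *)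

(* Defs.v *)
From HB Require Import structures.
From mathcomp Require Import all_boot all_order all_algebra.
From mathcomp Require Import reals.

Set Implicit Arguments.
Unset Strict Implicit.
Unset Printing Implicit Defensive.

Import Order.TTheory GRing.Theory Num.Theory.
Local Open Scope ring_scope.

(* [Order.Lattice] is not reused: [realDomainType] already joins it with
   [zmodType], and Hierarchy Builder rejects a second such join that
   [realDomainType] does not inherit from. *)
HB.mixin Record POrderedZmodule_isRiesz (R : realType) E
    of Num.POrderedZmodule E & GRing.Lmodule R E := {
  riesz_leD : forall z x y : E, x <= y -> x + z <= y + z;
  riesz_scale_ge0 : forall (a : R) (x : E), 0 <= a -> 0 <= x -> 0 <= a *: x;
  rjoin : E -> E -> E;
  rmeet : E -> E -> E;
  rjoin_le : forall x y z : E, (rjoin x y <= z) = (x <= z) && (y <= z);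
  le_rmeet : forall x y z : E, (z <= rmeet x y) = (z <= x) && (z <= y)
}.

#[short(type="rieszType")]
HB.structure Definition Riesz (R : realType) :=
  { E of Num.POrderedZmodule E & GRing.Lmodule R E
       & POrderedZmodule_isRiesz R E }.

Notation "x '\vee' y" := (rjoin x y)
  (at level 52, left associativity) : ring_scope.
Notation "x '\wedge' y" := (rmeet x y)
  (at level 48, left associativity) : ring_scope.

Definition rpos (R : realType) (E : rieszType R) (x : E) : E := x \vee 0.
Definition rneg (R : realType) (E : rieszType R) (x : E) : E := (- x) \vee 0.
Definition rabs (R : realType) (E : rieszType R) (x : E) : E := x \vee (- x).

(* A truncation is a map on the positive cone only: it is encoded as a total
   function about which nothing is assumed, and which is never used, outside
   the cone.  [trunc_neq0] also entails that the space is nonzero. *)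
HB.mixin Record Riesz_isTruncated (R : realType) E of Riesz R E := {
  trunc : E -> E;
  trunc_ge0 : forall x : E, 0 <= x -> 0 <= trunc x;
  trunc_neq0 : exists2 x : E, 0 <= x & trunc x <> 0;
  trunc_meet : forall x y : E, 0 <= x -> 0 <= y -> x \wedge trunc y <= trunc x;
  trunc_le : forall x : E, 0 <= x -> trunc x <= x
}.

#[short(type="truncRieszType")]
HB.structure Definition TruncRiesz (R : realType) :=
  { E of Riesz R E & Riesz_isTruncated R E }.

Record is_lattice_norm (R : realType) (E : rieszType R) (N : E -> R) : Prop :=
  IsLatticeNorm {
  lnorm_eq0 : forall x, N x = 0 -> x = 0;
  lnormZ : forall (a : R) x, N (a *: x) = `|a| * N x;
  lnormD : forall x y, N (x + y) <= N x + N y;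
  lnorm_mono : forall x y, rabs x <= rabs y -> N x <= N y
}.

Section RieszTheory.
Variables (R : realType) (E : rieszType R).
Implicit Types (x y z : E) (a : R).

Lemma rjoin_ubl x y : x <= x \vee y.
Proof. by have := lexx (x \vee y); rewrite rjoin_le => /andP[]. Qed.

Lemma rjoin_ubr x y : y <= x \vee y.
Proof. by have := lexx (x \vee y); rewrite rjoin_le => /andP[]. Qed.

Lemma rmeet_lbl x y : x \wedge y <= x.
Proof. by have := lexx (x \wedge y); rewrite le_rmeet => /andP[]. Qed.

Lemma rmeet_lbr x y : x \wedge y <= y.
Proof. by have := lexx (x \wedge y); rewrite le_rmeet => /andP[]. Qed.

Lemma rjoinC x y : x \vee y = y \vee x.
Proof. by apply/le_anti; rewrite !rjoin_le !rjoin_ubl !rjoin_ubr. Qed.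

Lemma rjoin_idl x y : y <= x -> x \vee y = x.
Proof. by move=> yx; apply/le_anti; rewrite rjoin_le rjoin_ubl lexx yx. Qed.

Lemma rmeet_idl x y : x <= y -> x \wedge y = x.
Proof. by move=> xy; apply/le_anti; rewrite le_rmeet rmeet_lbl lexx xy. Qed.

Lemma rmeet_idr x y : y <= x -> x \wedge y = y.
Proof. by move=> yx; apply/le_anti; rewrite le_rmeet rmeet_lbr lexx yx. Qed.

Lemma riesz_leD2r z x y : (x + z <= y + z) = (x <= y).
Proof.
apply/idP/idP => [/(riesz_leD (- z))|]; last exact: riesz_leD.
by rewrite !addrK.
Qed.

Lemma riesz_subr_ge0 x y : (0 <= y - x) = (x <= y).
Proof. by rewrite -(riesz_leD2r x 0) add0r subrK. Qed.

Lemma riesz_oppr_le0 x : (- x <= 0) = (0 <= x).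
Proof. by rewrite -(riesz_leD2r x (- x)) addNr add0r. Qed.

Lemma riesz_lerBl x y z : (x - y <= z) = (x <= z + y).
Proof. by rewrite -(riesz_leD2r y (x - y)) subrK. Qed.

Lemma riesz_addr_ge0 x y : 0 <= x -> 0 <= y -> 0 <= x + y.
Proof.
move=> x0 y0; apply: le_trans y0 _.
by rewrite -{1}[y]add0r riesz_leD2r.
Qed.

Lemma riesz_leDD x y x' y' : x <= x' -> y <= y' -> x + y <= x' + y'.
Proof.
move=> xx yy; apply: (@le_trans _ _ (x' + y)); first by rewrite riesz_leD2r.
by rewrite ![x' + _]addrC riesz_leD2r.
Qed.

Lemma riesz_scale_le a x y : 0 <= a -> x <= y -> a *: x <= a *: y.
Proof.
by move=> a0; rewrite -riesz_subr_ge0 -[a *: x <= _]riesz_subr_ge0 -scalerBr;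
  exact: riesz_scale_ge0.
Qed.

Lemma riesz_scaleV_le a x y : 0 < a -> (a^-1 *: x <= y) = (x <= a *: y).
Proof.
move=> a0; have aN0 : a != 0 by rewrite gt_eqF.
apply/idP/idP => [/(riesz_scale_le (ltW a0))|].
  by rewrite scalerA divff// scale1r.
have /ltW ai0 : 0 < a^-1 by rewrite invr_gt0.
by move=> /(riesz_scale_le ai0); rewrite scalerA mulVf// scale1r.
Qed.

Lemma rjoinDr x y z : (x + z) \vee (y + z) = (x \vee y) + z.
Proof.
apply/le_anti; rewrite rjoin_le !riesz_leD2r rjoin_ubl rjoin_ubr/=.
rewrite -[z in X in X <= _]opprK riesz_lerBl rjoin_le -!riesz_lerBl opprK.
by rewrite rjoin_ubl rjoin_ubr.
Qed.

Lemma riesz_scale_join a x y : 0 < a ->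
  a *: (x \vee y) = (a *: x) \vee (a *: y).
Proof.
move=> a0; have ai0 : 0 < a^-1 by rewrite invr_gt0.
apply/le_anti/andP; split.
  rewrite -[a in X in X <= _]invrK riesz_scaleV_le// rjoin_le.
  by rewrite -!riesz_scaleV_le// invrK rjoin_ubl rjoin_ubr.
by rewrite rjoin_le !riesz_scale_le ?rjoin_ubl ?rjoin_ubr// ltW.
Qed.

Lemma rpos_ge0 x : 0 <= rpos x. Proof. exact: rjoin_ubr. Qed.
Lemma rneg_ge0 x : 0 <= rneg x. Proof. exact: rjoin_ubr. Qed.

Lemma rpos_id x : 0 <= x -> rpos x = x. Proof. exact: rjoin_idl. Qed.

Lemma rnegN x : rneg (- x) = rpos x. Proof. by rewrite /rneg opprK. Qed.

Lemma rpos_rneg x : rpos x = x + rneg x.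
Proof. by rewrite /rneg addrC -rjoinDr addNr add0r rjoinC. Qed.

Lemma rnegZ a x : 0 < a -> rneg (a *: x) = a *: rneg x.
Proof. by move=> a0; rewrite /rneg riesz_scale_join// scaler0 scalerN. Qed.

Lemma rabsE x : rabs x = x + rneg x *+ 2.
Proof.
rewrite -scaler_nat -rnegZ// scaler_nat /rabs /rneg addrC -rjoinDr.
by rewrite add0r mulr2n opprD subrK rjoinC.
Qed.

Lemma rmeetE x y : x \wedge y = x - rpos (x - y).
Proof.
apply/le_anti/andP; split; last first.
  rewrite le_rmeet !riesz_lerBl -[X in X <= _]addr0.
  rewrite riesz_leDD ?rpos_ge0//=.
  by rewrite addrC -riesz_lerBl rjoin_ubl.
rewrite -riesz_subr_ge0 addrAC riesz_subr_ge0 rjoin_le riesz_subr_ge0.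
by rewrite rmeet_lbl andbT riesz_leDD// -riesz_subr_ge0 opprK addrC
  riesz_subr_ge0 rmeet_lbr.
Qed.

Lemma rabsN x : rabs (- x) = rabs x.
Proof. by rewrite /rabs opprK rjoinC. Qed.

End RieszTheory.

(* The pair (x, a) stands for x + a. *)
Definition unitization (R : realType) (E : truncRieszType R) : Type :=
  (E * R^o)%type.

HB.instance Definition _ (R : realType) (E : truncRieszType R) :=
  GRing.Lmodule.copy (unitization E) (E * R^o)%type.

Section Unitization.
Variables (R : realType) (E : truncRieszType R).
Implicit Types (x y r s : E) (a : R) (u v w : unitization E).

Definition uinj x : unitization E := (x, 0).
Definition uone : unitization E := (0, 1).

Definition uge0 u : bool :=
  ((u.2 == 0) && (0 <= u.1)) ||
  ((0 < u.2) && (trunc (u.2^-1 *: rneg u.1) == u.2^-1 *: rneg u.1)).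

(* The negative part (x + a)^- = x^- - a (x^- / a)^* of x + a, for a > 0; it
   lies in E. *)
Definition ucut x a : E := rneg x - a *: trunc (a^-1 *: rneg x).

Definition upos u : unitization E :=
  if u.2 == 0 then uinj (rpos u.1)
  else if 0 < u.2 then u + uinj (ucut u.1 u.2)
  else uinj (ucut (- u.1) (- u.2)).

Definition ule u v : bool := uge0 (v - u).
Definition ujoin u v : unitization E := v + upos (u - v).
Definition umeet u v : unitization E := u - upos (u - v).

Let tfix r := 0 <= r /\ trunc r = r.

Let tfix0 : tfix 0.
Proof. by split=> //; apply/le_anti; rewrite trunc_le// trunc_ge0. Qed.

Let tfix_trunc x : 0 <= x -> tfix (trunc x).
Proof.
move=> x0; have tx0 := trunc_ge0 _ x0; split=> //.
apply/le_anti; rewrite trunc_le//=.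
by have := trunc_meet _ _ tx0 x0; rewrite rmeet_idl.
Qed.

Let tfix_le r s : 0 <= r -> r <= s -> tfix s -> trunc r = r.
Proof.
move=> r0 rs [s0 ts]; apply/le_anti; rewrite trunc_le//=.
by have := trunc_meet _ _ r0 s0; rewrite ts rmeet_idl.
Qed.

Let tfixU r s : tfix r -> tfix s -> tfix (r \vee s).
Proof.
move=> [r0 tr] [s0 ts].
have rs0 : 0 <= r \vee s by exact: le_trans (rjoin_ubl _ _).
split=> //; apply/le_anti; rewrite trunc_le//= rjoin_le.
have := trunc_meet _ _ rs0 r0; have := trunc_meet _ _ rs0 s0.
rewrite tr ts (rmeet_idr (rjoin_ubr r s)) (rmeet_idr (rjoin_ubl r s)).
by move=> -> ->.
Qed.

Let uge0P x a : reflect (0 <= a /\ exists2 r, tfix r & - x <= a *: r)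
                        (uge0 (x, a)).
Proof.
rewrite /uge0/=; apply: (iffP orP) => [[/andP[/eqP-> x0]|/andP[a0 /eqP tx]]|].
- by split=> //; exists 0 => //; rewrite scaler0 riesz_oppr_le0.
- split; first exact: ltW.
  exists (a^-1 *: rneg x).
    split=> //; apply: riesz_scale_ge0; last exact: rneg_ge0.
    by rewrite invr_ge0 ltW.
  by rewrite scalerA divff ?gt_eqF// scale1r rjoin_ubl.
- move=> [a0 [r tr xr]]; move: a0; rewrite le_eqVlt => /predU1P[a0|a0].
    left; rewrite -a0 eqxx/=.
    by move: xr; rewrite -a0 scale0r riesz_oppr_le0.
  right; rewrite a0/=; apply/eqP; apply: tfix_le (tr).
    apply: riesz_scale_ge0; last exact: rneg_ge0.
    by rewrite invr_ge0 ltW.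
  rewrite riesz_scaleV_le// rjoin_le xr/=.
  by apply: riesz_scale_ge0; [exact: ltW|case: tr].
Qed.

Let uge0D u v : uge0 u -> uge0 v -> uge0 (u + v).
Proof.
case: u v => [x a] [y b] /uge0P[a0 [r tr xr]] /uge0P[b0 [s ts ys]].
apply/uge0P; split; first exact: addr_ge0.
exists (r \vee s); first exact: tfixU.
rewrite opprD scalerDl; apply: riesz_leDD.
  by apply: le_trans xr _; apply: riesz_scale_le => //; exact: rjoin_ubl.
by apply: le_trans ys _; apply: riesz_scale_le => //; exact: rjoin_ubr.
Qed.

Lemma uge0_inj x : uge0 (uinj x) = (0 <= x).
Proof. by rewrite /uge0/= eqxx ltxx orbF. Qed.

Let ucut_ge0 x a : 0 < a -> 0 <= ucut x a.
Proof.
move=> a0; rewrite riesz_subr_ge0.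
have t0 : 0 <= a^-1 *: rneg x.
  by apply: riesz_scale_ge0; [rewrite invr_ge0 ltW|exact: rneg_ge0].
have := riesz_scale_le (ltW a0) (trunc_le _ t0).
by rewrite scalerA divff ?gt_eqF// scale1r.
Qed.

Let ucutP x a w : 0 < a ->
  uge0 w && uge0 (w + (x, a)) = uge0 (w - uinj (ucut x a)).
Proof.
move=> a0; set c := ucut x a.
have t0 : 0 <= a^-1 *: rneg x.
  by apply: riesz_scale_ge0; [rewrite invr_ge0 ltW|exact: rneg_ge0].
apply/andP/idP => [|wc]; last first.
  have uc : uge0 (uinj c) by rewrite uge0_inj ucut_ge0.
  have ucx : uge0 (uinj c + (x, a)).
    apply/uge0P; rewrite add0r; split; first exact: ltW.
    exists (trunc (a^-1 *: rneg x)); first exact: tfix_trunc.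
    rewrite -riesz_subr_ge0 opprK addrA [_ + c]addrC subrK [_ + x]addrC.
    by rewrite -rpos_rneg rpos_ge0.
  split; first by rewrite -(subrK (uinj c) w); exact: uge0D.
  by rewrite -(subrK (uinj c) w) -addrA; exact: uge0D.
case: w => y b [/uge0P[b0 [r tr yr]] /uge0P[ab0 [s ts yxs]]].
apply/uge0P; rewrite /= subr0; split=> //.
have trs := tfixU tr ts; exists (r \vee s) => //.
move: (rjoin_ubl r s) (rjoin_ubr r s) trs; set q := r \vee s => rq sq [q0 tq].
pose z := y + b *: q.
have z0 : 0 <= z.
  rewrite /z addrC -riesz_lerBl add0r (le_trans yr)//.
  exact: riesz_scale_le.
have xz : rneg x <= a *: q + z.
  rewrite rjoin_le riesz_addr_ge0 ?riesz_scale_ge0 ?(ltW a0)// andbT.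
  rewrite /z addrCA addrC -riesz_lerBl -opprD -scalerDl.
  rewrite [x + y]addrC [a + b]addrC.
  by rewrite (le_trans yxs)// riesz_scale_le.
have : a^-1 *: (rneg x - z) <= trunc (a^-1 *: rneg x).
  apply: le_trans (trunc_meet _ _ t0 q0).
  rewrite le_rmeet tq; apply/andP; split.
    apply: riesz_scale_le; first by rewrite invr_ge0 ltW.
    by rewrite riesz_lerBl -[X in X <= _]addr0 riesz_leDD.
  by rewrite riesz_scaleV_le// riesz_lerBl.
rewrite riesz_scaleV_le// riesz_lerBl => le_nz.
by rewrite opprB !riesz_lerBl addrC [b *: q + y]addrC.
Qed.

Let uposP u w : uge0 w && uge0 (w - u) = uge0 (w - upos u).
Proof.
case: u => x a; rewrite /upos/=; case: eqP => [->|/eqP aN0].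
  have subE y y' b : (y, b) - uinj y' = (y - y', b) :> unitization E.
    by rewrite -[LHS]/(_ , _); congr pair; rewrite subr0.
  case: w => y b; rewrite !subE; apply/andP/idP.
    move=> [/uge0P[b0 [r tr yr]] /uge0P[_ [s ts yxs]]].
    apply/uge0P; split=> //; exists (r \vee s); first exact: tfixU.
    rewrite opprB riesz_lerBl rjoin_le -!riesz_lerBl sub0r -opprB.
    rewrite (le_trans yxs) ?(le_trans yr)// riesz_scale_le ?rjoin_ubl//.
    exact: rjoin_ubr.
  move=> yx; have posD z : 0 <= z -> uge0 (y - rpos x + z, b).
    rewrite -uge0_inj => /(uge0D yx); congr uge0.
    by rewrite -[LHS]/(_ , _); congr pair; rewrite addr0.
  split; first by rewrite -(subrK (rpos x) y) posD ?rpos_ge0.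
  rewrite -[y](subrK (rpos x)) -addrA posD// riesz_subr_ge0.
  exact: rjoin_ubl.
case: ltP => a0.
  rewrite opprD addrA -ucutP// subrK andbC; congr andb.
by rewrite -ucutP// oppr_gt0 lt_neqAle aN0.
Qed.

Lemma ule_refl : reflexive ule.
Proof. by move=> u; rewrite /ule subrr uge0_inj. Qed.

Lemma ule_anti : antisymmetric ule.
Proof.
move=> u v; rewrite /ule => /andP[].
rewrite -[v - u]opprB; case: (u - v) (subrK v u) => x a <- {u}.
move=> /uge0P[/= a0 [r tr xr]] /uge0P[/= a0' [s ts xs]].
have aE : a = 0.
  move: (a0 : 0 <= - (a : R)); rewrite oppr_ge0 => al0.
  by apply/le_anti; rewrite al0.
move: xr xs; rewrite aE oppr0 !scale0r opprK riesz_oppr_le0 => x0 x0'.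
have -> : x = 0 by apply/le_anti; rewrite x0.
exact: add0r.
Qed.

Lemma ule_trans : transitive ule.
Proof.
move=> v u w uv vw; rewrite /ule -(subrK v w) -addrA; exact: uge0D.
Qed.

HB.instance Definition _ := Order.Le_isPOrder.Build ring_display
  (unitization E) ule_refl ule_anti ule_trans.

Lemma uleE u v : (u <= v) = uge0 (v - u). Proof. by []. Qed.

Lemma uleD w u v : u <= v -> u + w <= v + w.
Proof. by rewrite !uleE opprD addrACA subrr addr0. Qed.

Lemma uscale_ge0 a u : 0 <= a -> 0 <= u -> 0 <= a *: u.
Proof.
rewrite !uleE !subr0; case: u => x b a0 /uge0P[b0 [r tr xr]].
apply/uge0P; split; first exact: mulr_ge0.
exists r => //; rewrite -scalerN -scalerA.
exact: riesz_scale_le.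
Qed.

Lemma ujoin_le u v w : (ujoin u v <= w) = (u <= w) && (v <= w).
Proof.
rewrite !uleE /ujoin opprD addrA -uposP andbC; congr andb.
by rewrite opprB addrA subrK.
Qed.

Lemma ule_meet u v w : (w <= umeet u v) = (w <= u) && (w <= v).
Proof.
rewrite !uleE /umeet addrAC -uposP; congr andb.
by rewrite opprB [u - w + _]addrC addrA subrK.
Qed.

HB.instance Definition _ := POrderedZmodule_isRiesz.Build R
  (unitization E) uleD uscale_ge0 ujoin_le ule_meet.

Lemma uge0E x a : ((0 : unitization E) <= (x, a)) =
  ((a == 0) && (0 <= x)) ||
  ((0 < a) && (trunc (a^-1 *: rneg x) == a^-1 *: rneg x)).
Proof. by rewrite uleE subr0. Qed.

Lemma urjoinE u v : u \vee v = v + upos (u - v). Proof. by []. Qed.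
Lemma urmeetE u v : u \wedge v = u - upos (u - v). Proof. by []. Qed.

Lemma uinj_le x y : (uinj x <= uinj y) = (x <= y).
Proof.
rewrite uleE (_ : _ - _ = uinj (y - x)) ?uge0_inj ?riesz_subr_ge0//.
by rewrite /uinj -[RHS]/(_ , _); congr pair; rewrite subr0.
Qed.

Lemma uinj_join x y : uinj (x \vee y) = uinj x \vee uinj y.
Proof.
rewrite urjoinE /upos/= subrr eqxx; congr pair; last by rewrite /= addr0.
by rewrite /= /rpos addrC -rjoinDr subrK add0r.
Qed.

Lemma uinj_meet x y : uinj (x \wedge y) = uinj x \wedge uinj y.
Proof.
rewrite urmeetE /upos/= subrr eqxx -[RHS]/(_ , _).
by rewrite -rmeetE; congr pair; rewrite /= oppr0 addr0.
Qed.

Lemma uinj_trunc x : 0 <= x -> uinj (trunc x) = uone \wedge uinj x.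
Proof.
move=> x0; rewrite urmeetE /upos/= subr0 oner_eq0 ltr01.
rewrite opprD addrA opprB [uone + _]addrC subrK sub0r /ucut rnegN rpos_id//.
rewrite invr1 !scale1r -[RHS]/(_ , _).
by congr pair; rewrite /= ?oppr0 ?addr0 ?opprB ?[x + _]addrC ?subrK.
Qed.

Lemma uabs_inj x : rabs (uinj x) = uinj (rabs x).
Proof.
rewrite /rabs uinj_join; congr (_ \vee _).
by rewrite -[LHS]/(_ , _) /= oppr0.
Qed.

Lemma uabsE x a : a != 0 ->
  rabs ((x, a) : unitization E) =
  (rabs x - (2 * `|a|) *:
     trunc ((a^-1 *: rneg x) \vee (- a^-1 *: rpos x)), `|a|).
Proof.
wlog a0 : x a / 0 < a => [hw aN0|_].
  have [a0|a0] := ltP 0 a; first exact: hw.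
  have Na0 : 0 < - a by rewrite oppr_gt0 lt_neqAle aN0.
  rewrite -rabsN (_ : - _ = (- x, - a) :> unitization E)//.
  rewrite (hw _ _ Na0 (lt0r_neq0 Na0)) rabsN normrN rnegN invrN opprK.
  by rewrite /rpos -/(rneg x) rjoinC.
have ai0 : 0 < a^-1 by rewrite invr_gt0.
rewrite rjoin_idl; last first.
  apply: (@le_trans _ _ 0).
    by rewrite scaleNr riesz_oppr_le0 riesz_scale_ge0 ?rpos_ge0// ltW.
  by rewrite riesz_scale_ge0 ?rneg_ge0// ltW.
have a20 : 0 < a + a by rewrite addr_gt0.
rewrite [LHS]urjoinE /upos/= !opprK gt_eqF// a20 addrA addrA addNr add0r.
rewrite -[LHS]/(_ , _) gtr0_norm//; congr pair; last by rewrite /= addr0.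
rewrite /= /ucut -[x + x]mulr2n -scaler_nat rnegZ// scalerA.
rewrite -[a + a]mulr2n -[a *+ 2]mulr_natl.
rewrite invfM mulrAC mulVf ?mul1r ?pnatr_eq0//.
by rewrite rabsE addrA scaler_nat.
Qed.

End Unitization.

(* Main.v *)
Require Import Defs.
From HB Require Import structures.
From mathcomp Require Import all_boot all_order all_algebra.
From mathcomp Require Import classical_sets reals.

Import Order.TTheory GRing.Theory Num.Theory.
Local Open Scope ring_scope.

Set Implicit Arguments.
Unset Strict Implicit.

(** If a lattice norm [N'] extends [N], then [x^* = 1 /\ x <= 1] shows that
    [N' 1] bounds the truncation.

    Conversely, let [M > 0] bound the norms of all truncated elements.  Every
    element of the unitization lies, in absolute value, below some [y + b] with
    [y] in [E] and [b] real, and a lattice norm extending [N] that gives norm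
    [M] to [1] cannot exceed [N y + M b] there.  The extension is the largest
    one these majorants permit:
      [N' u = inf {N y + M b : |u| <= y + b}].
    Such an infimum of a sublinear function is always a lattice seminorm (the
    section on majorants).  It remains to see that it is not too small.
    - On [E] it equals [N]: the majorant [|x|] gives one inequality.  For the
      other ([lnorm_le_cost]), [|x| <= y + b] with [b > 0] says that
      [(y - |x|)^- / b] is fixed by the truncation; hence its norm is at most
      [M], and [|x| <= y + (y - |x|)^-] yields [N x <= N y + b M].
    - It is definite: [|x + a| <= y + b] forces [|a| <= b], so
      [M |a| <= N' (x + a)]; thus [N' (x + a) = 0] gives [a = 0], and then
      [N x = 0]. *)

(** * Absolute values and lattice norms in Riesz spaces *)

Section RieszComplements.
Variables (R : realType) (E : rieszType R).
Implicit Types (x y z : E) (a : R).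

Lemma rabs_ge0 x : 0 <= rabs x.
Proof.
rewrite rabsE mulr2n addrA -rpos_rneg.
by rewrite riesz_addr_ge0 ?rpos_ge0 ?rneg_ge0.
Qed.

Lemma rabs_id x : 0 <= x -> rabs x = x.
Proof.
by move=> x0; rewrite /rabs rjoin_idl// (le_trans _ x0)// riesz_oppr_le0.
Qed.

Lemma rabsD x y : rabs (x + y) <= rabs x + rabs y.
Proof.
by rewrite {1}/rabs rjoin_le opprD !riesz_leDD ?rjoin_ubl ?rjoin_ubr.
Qed.

Lemma rabsZ a x : rabs (a *: x) = `|a| *: rabs x.
Proof.
have pos b : 0 < b -> rabs (b *: x) = b *: rabs x.
  by move=> b0; rewrite /rabs riesz_scale_join// scalerN.
have [a0|a0|<-] := ltgtP 0 a.
- by rewrite pos ?gtr0_norm.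
- by rewrite -rabsN -scaleNr pos ?oppr_gt0// ltr0_norm.
- by rewrite normr0 !scale0r rabs_id.
Qed.

Section LatticeNorm.
Variables (N : E -> R) (hN : is_lattice_norm N).

Lemma lnorm0 : N 0 = 0.
Proof. by rewrite -(scale0r 0) (lnormZ hN) normr0 mul0r. Qed.

Lemma lnorm_ge0 x : 0 <= N x.
Proof. by rewrite -lnorm0 (lnorm_mono hN)// rabs_id// rabs_ge0. Qed.

Lemma lnorm_rabs x : N (rabs x) = N x.
Proof.
by apply/le_anti; rewrite !(lnorm_mono hN)// (rabs_id (rabs_ge0 x)).
Qed.

Lemma lnorm_le x y : 0 <= x -> x <= y -> N x <= N y.
Proof.
move=> x0 xy; apply: (lnorm_mono hN); rewrite rabs_id//.
exact: le_trans xy (rjoin_ubl _ _).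
Qed.

End LatticeNorm.
End RieszComplements.

(** * Lattice seminorms from majorants *)

Section MajorantSeminorm.
Variables (R : realType) (F : rieszType R) (p : F -> R).
Implicit Types (u v w : F) (a c : R).

(** For [p] sublinear and nonnegative on the positive cone, this is the largest
    lattice seminorm that is at most [p] there: any such seminorm [q] satisfies
    [q u <= q v <= p v] as soon as [|u| <= v]. *)
Definition majorant_norm u : R :=
  inf [set p v | v in [set v | rabs u <= v]]%classic.

Hypothesis p_ge0 : forall v, 0 <= v -> 0 <= p v.
Hypothesis pZ : forall a v, 0 <= a -> p (a *: v) = a * p v.
Hypothesis pD : forall v w, p (v + w) <= p v + p w.

Lemma majorant_norm_le u v : rabs u <= v -> majorant_norm u <= p v.
Proof.
move=> uv; apply: ge_inf; last by exists v.
exists 0 => _ [w /= uw <-]; apply: p_ge0.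
exact: le_trans (rabs_ge0 u) uw.
Qed.

Lemma le_majorant_norm u c :
  (forall v, rabs u <= v -> c <= p v) -> c <= majorant_norm u.
Proof.
move=> cp; apply: lb_le_inf; first by exists (p (rabs u)), (rabs u) => /=.
by move=> _ [w /= uw <-]; exact: cp.
Qed.

Lemma majorant_norm_mono u v :
  rabs u <= rabs v -> majorant_norm u <= majorant_norm v.
Proof.
move=> uv; apply: le_majorant_norm => w vw.
by apply: majorant_norm_le; exact: le_trans vw.
Qed.

Lemma majorant_normD u v :
  majorant_norm (u + v) <= majorant_norm u + majorant_norm v.
Proof.
rewrite -lerBlDr; apply: le_majorant_norm => u' uu'.
rewrite lerBlDr -lerBlDl; apply: le_majorant_norm => v' vv'.
rewrite lerBlDl; apply: le_trans (pD _ _); apply: majorant_norm_le.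
by apply: le_trans (rabsD _ _) _; exact: riesz_leDD.
Qed.

(** Scaling by [a] maps majorants of [u] to majorants of [a *: u], which gives
    one inequality; the other is the same inequality for [a^-1]. *)
Lemma majorant_normZ a u : majorant_norm (a *: u) = `|a| * majorant_norm u.
Proof.
have [->|a0] := eqVneq a 0.
  rewrite scale0r normr0 mul0r; apply/le_anti/andP; split.
    by rewrite -(mul0r (p 0)) -pZ// scale0r majorant_norm_le// rabs_id.
  apply: le_majorant_norm => v; rewrite rabs_id//; exact: p_ge0.
have scale_le b w : b != 0 -> majorant_norm (b *: w) <= `|b| * majorant_norm w.
  move=> b0; rewrite mulrC -ler_pdivrMr ?normr_gt0//.
  apply: le_majorant_norm => v wv; rewrite ler_pdivrMr ?normr_gt0// mulrC.
  rewrite -pZ//; apply: majorant_norm_le.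
  by rewrite rabsZ riesz_scale_le.
apply/le_anti; rewrite scale_le//=.
rewrite mulrC -ler_pdivlMr ?normr_gt0// mulrC -normfV.
have /(scale_le _ (a *: u)) : a^-1 != 0 by rewrite invr_eq0.
by rewrite scalerA mulVf// scale1r.
Qed.

End MajorantSeminorm.

(** * Extension to the unitization *)

Section Extension.
Variables (R : realType) (E : truncRieszType R).
Implicit Types (x y : E) (a : R) (u v : unitization E).

Lemma rabs_unitization_snd u : (rabs u).2 = `|u.2|.
Proof.
case: u => x a; have [->|a0] := eqVneq a 0.
  by rewrite normr0; exact: (congr1 snd (uabs_inj x)).
exact: (congr1 snd (uabsE x a0)).
Qed.

Lemma unitization_le_snd u v : u <= v -> u.2 <= v.2.
Proof.
rewrite uleE -subr_ge0 -[v.2 - u.2]/((v - u).2) /uge0.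
by case/orP => /andP[]; [move=> /eqP -> | move=> /ltW].
Qed.

Variables (N : E -> R) (hN : is_lattice_norm N).

Section Cost.
Variable M : R.

(** The bound that the triangle inequality imposes at [y + b], for [b >= 0], on
    a norm extending [N] and giving norm [M] to [1]. *)
Definition cost v : R := N v.1 + M * v.2.

Lemma costZ a v : 0 <= a -> cost (a *: v) = a * cost v.
Proof.
by move=> a0; rewrite /cost /= (lnormZ hN) ger0_norm// mulrDr mulrCA.
Qed.

Lemma costD u v : cost (u + v) <= cost u + cost v.
Proof. by rewrite /cost /= mulrDr addrACA lerD2r (lnormD hN). Qed.

Hypothesis M_gt0 : 0 < M.

Lemma cost_ge0 v : 0 <= v -> 0 <= cost v.
Proof.
move=> /unitization_le_snd v0; apply: addr_ge0; first exact: lnorm_ge0.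
by rewrite mulr_ge0// ltW.
Qed.

Hypothesis trunc_bound : forall x, 0 <= x -> N (trunc x) <= M.

(** This is where the bound on the truncation enters: the excess
    [(y - |x|)^-] of [|x|] over [y] is a [b]-multiple of a truncated element
    and so has norm at most [b * M]. *)
Lemma lnorm_le_cost x v : uinj (rabs x) <= v -> N x <= cost v.
Proof.
case: v => y b; rewrite /cost /= -(lnorm_rabs hN x).
have := rabs_ge0 x; move: (rabs x) => z z0.
rewrite -[_ <= _]/(uge0 (y - z, b - 0)) subr0 /uge0 /=.
case/orP => /andP[].
  move=> /eqP->; rewrite riesz_subr_ge0 mulr0 addr0; exact: lnorm_le.
move=> b0 /eqP fixed.
have excess_ge0 : 0 <= b^-1 *: rneg (y - z).
  by rewrite riesz_scale_ge0 ?rneg_ge0// invr_ge0 ltW.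
have zle : z <= y + rneg (y - z).
  by rewrite addrC -riesz_lerBl -opprB rjoin_ubl.
apply: le_trans (lnorm_le hN z0 zle) _.
apply: le_trans (lnormD hN _ _) _; rewrite lerD2l.
have -> : rneg (y - z) = b *: trunc (b^-1 *: rneg (y - z)).
  by rewrite fixed scalerA mulfV ?gt_eqF// scale1r.
by rewrite (lnormZ hN) gtr0_norm// mulrC ler_pM2r// trunc_bound.
Qed.

Lemma majorant_norm_cost_inj x : majorant_norm cost (uinj x) = N x.
Proof.
apply/le_anti/andP; split; last first.
  apply: le_majorant_norm => v; rewrite uabs_inj; exact: lnorm_le_cost.
have -> : N x = cost (uinj (rabs x)).
  by rewrite /cost /= mulr0 addr0 lnorm_rabs.
by apply: majorant_norm_le; [exact: cost_ge0 | rewrite uabs_inj].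
Qed.

Lemma le_majorant_norm_cost u : M * `|u.2| <= majorant_norm cost u.
Proof.
apply: le_majorant_norm => v /unitization_le_snd.
rewrite rabs_unitization_snd => uv.
rewrite -[X in X <= _]add0r; apply: lerD; first exact: lnorm_ge0.
by rewrite ler_pM2l.
Qed.

Lemma majorant_norm_cost_lattice_norm :
  is_lattice_norm (majorant_norm cost).
Proof.
split.
- move=> u u_eq0; have u2 : u.2 = 0.
    have := le_majorant_norm_cost u.
    by rewrite u_eq0 pmulr_rle0// normr_le0 => /eqP.
  case: u u2 u_eq0 => x a /= ->; rewrite (majorant_norm_cost_inj x).
  by move=> /(lnorm_eq0 hN) ->.
- by move=> a u; apply: majorant_normZ; [exact: cost_ge0 | exact: costZ].
- by move=> u v; apply: majorant_normD; [exact: cost_ge0 | exact: costD].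
- by move=> u v; apply: majorant_norm_mono; exact: cost_ge0.
Qed.

End Cost.

Lemma lnorm_trunc_le (N' : unitization E -> R) x :
  is_lattice_norm N' -> (forall y, N' (uinj y) = N y) -> 0 <= x ->
  N (trunc x) <= N' (uone E).
Proof.
move=> hN' ext x0; rewrite -ext; apply: (lnorm_le hN').
  by rewrite (uinj_le 0) trunc_ge0.
by rewrite uinj_trunc// rmeet_lbl.
Qed.

End Extension.

Unset Implicit Arguments.
Set Strict Implicit.

Theorem mainTheorem1 (R : realType) (E : truncRieszType R) (N : E -> R)
    (hN : is_lattice_norm N) :
  (exists N' : unitization E -> R,
      is_lattice_norm N' /\ forall x : E, N' (uinj x) = N x) <->
  (exists M : R, 0 < M /\ forall x : E, 0 <= x -> N (trunc x) <= M).
Proof.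
split=> [[N' [hN' ext]]|[M [M0 bound]]].
  exists (N' (uone E)); split; last by move=> x; exact: lnorm_trunc_le.
  rewrite lt_neqAle lnorm_ge0// andbT eq_sym; apply/eqP => /(lnorm_eq0 hN').
  by move=> [/eqP]; rewrite oner_eq0.
exists (majorant_norm (cost N M)); split.
  exact: majorant_norm_cost_lattice_norm.
by move=> x; exact: majorant_norm_cost_inj.
Qed.
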